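(* Let $k\ge 1$ and let $\zeta_1,\dots,\zeta_k>-1$ and $\alpha_1,\dots,\alpha_k>0$ be real. Let $x_1,\dots,x_k$ be mutually independent real random variables, $x_j$ having the type-1 beta density $$f_j(x_j)=\frac{\Gamma(\alpha_j+\zeta_j+1)}{\Gamma(\alpha_j)\Gamma(\zeta_j+1)}x_j^{\zeta_j}(1-x_j)^{\alpha_j-1},\quad 0<x_j<1,$$ and $f_j=0$ elsewhere. Let $(v_1,\dots,v_k)$ be a random vector of positive real random variables with an arbitrary joint density $f(v_1,\dots,v_k)$ on $(0,\infty)^k$, and assume $(x_1,\dots,x_k)$ and $(v_1,\dots,v_k)$ are independent. Put $u_j=x_jv_j$, $j=1,\dots,k$, and let $g(u_1,\dots,u_k)$ denote the joint density of $(u_1,\dots,u_k)$. Then, for (almost every) $(u_1,\dots,u_k)\in(0,\infty)^k$, $$\Big\{\prod_{j=1}^k\frac{\Gamma(\zeta_j+1)}{\Gamma(\alpha_j+\zeta_j+1)}\Big\}\,g(u_1,\dots,u_k)=K_{u_j,j=1,\dots,k}^{(\zeta_j,\alpha_j),j=1,\dots,k}f(u_1,\dots,u_k).$$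
   Context: The multivariable Kober fractional integral operator of the second kind is defined by $$K_{u_j,j=1,\dots,k}^{(\zeta_j,\alpha_j),j=1,\dots,k}f(u_1,\dots,u_k)=\Big\{\prod_{j=1}^k\frac{u_j^{\zeta_j}}{\Gamma(\alpha_j)}\Big\}\int_{v_1>u_1}\cdots\int_{v_k>u_k}\Big\{\prod_{j=1}^k(v_j-u_j)^{\alpha_j-1}v_j^{-\zeta_j-\alpha_j}\Big\}f(v_1,\dots,v_k)\,dv_1\cdots dv_k.$$ *)

(* Defs.v *)
From HB Require Import structures.
From mathcomp Require Import all_boot all_order all_algebra.
From mathcomp Require Import all_classical all_reals all_analysis.
Set Implicit Arguments. Unset Strict Implicit. Unset Printing Implicit Defensive.
Import Order.TTheory GRing.Theory Num.Theory.
Import numFieldNormedType.Exports.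
Local Open Scope classical_set_scope.
Local Open Scope ring_scope.

Section Defs.
Variable R : realType.
Local Notation leb := (@lebesgue_measure R).

Definition Gamma (s : R) : R :=
  fine (\int[leb]_(t in `]0%R, +oo[%classic) ((t `^ (s - 1)) * expR (- t))%:E)%E.

(** Iterated Lebesgue integral over R^n (points of R^n are n-tuples):
    iint n F = int_R ... int_R F(x_1,...,x_n) dx_n ... dx_1.
    For nonnegative measurable F this is (Tonelli) the integral of F
    with respect to the n-dimensional Lebesgue measure. *)
Fixpoint iint (n : nat) : (n.-tuple R -> \bar R) -> \bar R :=
  match n with
  | 0 => fun F => F [tuple]
  | n'.+1 => fun F =>
      (\int[leb]_x iint (fun t : n'.-tuple R => F (cons_tuple x t)))%E
  end.

Definition lebn (n : nat) (A : set (n.-tuple R)) : \bar R :=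
  iint (fun t => (\1_A t)%:E).

Definition ae_lebn (n : nat) (D : set (n.-tuple R)) (Q : n.-tuple R -> Prop) :=
  exists N : set (n.-tuple R),
    measurable N /\ lebn N = 0%E /\ forall u, D u -> ~ N u -> Q u.

Definition beta1_pdf (zeta alpha : R) (x : R) : R :=
  if (0 < x) && (x < 1) then
    Gamma (alpha + zeta + 1) / (Gamma alpha * Gamma (zeta + 1))
    * x `^ zeta * (1 - x) `^ (alpha - 1)
  else 0.

Definition posorthant (n : nat) : set (n.-tuple R) :=
  [set u | forall j : 'I_n, 0 < tnth u j].

Definition Kober2 (k : nat) (zeta alpha : 'I_k -> R)
    (f : k.-tuple R -> R) (u : k.-tuple R) : \bar R :=
  ((\prod_(j < k) (tnth u j `^ zeta j / Gamma (alpha j)))%:E *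
   iint (fun v : k.-tuple R =>
     (\1_[set v' : k.-tuple R | forall j, tnth u j < tnth v' j] v *
      ((\prod_(j < k) ((tnth v j - tnth u j) `^ (alpha j - 1) *
                       tnth v j `^ (- zeta j - alpha j))) * f v))%:E))%E.

Section Prob.
Context d (T : measurableType d) (P : probability T R).

Definition has_density1 (X : T -> R) (p : R -> R) :=
  [/\ measurable_fun setT p, (forall x, 0 <= p x) &
      forall A : set R, measurable A ->
        P (X @^-1` A) = (\int[leb]_(x in A) (p x)%:E)%E].

Definition has_joint_density (n : nat) (X : T -> n.-tuple R)
    (p : n.-tuple R -> R) :=
  [/\ measurable_fun setT p, (forall x, 0 <= p x) &
      forall B : set (n.-tuple R), measurable B ->
        P (X @^-1` B) = iint (fun t => (\1_B t * p t)%:E)].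

Definition mutually_independent (n : nat) (X : 'I_n -> T -> R) :=
  forall A : 'I_n -> set R, (forall j, measurable (A j)) ->
    P (\bigcap_(j in [set: 'I_n]) (X j @^-1` A j)) =
    (\prod_(j < n) P (X j @^-1` A j))%E.

Definition independent_vectors (n m : nat) (X : T -> n.-tuple R)
    (Y : T -> m.-tuple R) :=
  forall (A : set (n.-tuple R)) (B : set (m.-tuple R)),
    measurable A -> measurable B ->
    P (X @^-1` A `&` Y @^-1` B) = (P (X @^-1` A) * P (Y @^-1` B))%E.

End Prob.
End Defs.

(* Main.v *)
Require Import Defs.
From HB Require Import structures.
From mathcomp Require Import all_boot all_order all_algebra.
From mathcomp Require Import all_classical all_reals all_analysis.
From mathcomp Require Import measurable_realfun ring.
Import Order.TTheory GRing.Theory Num.Theory.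
Local Open Scope classical_set_scope.
Local Open Scope ring_scope.

(** Independence makes the law of (x, v) the product of the two joint densities
    (uniqueness of finite measures on a pi-system).  For fixed v the substitution
    u_j = x_j v_j has Jacobian prod_j 1/v_j, so Tonelli exhibits
      h(u) = int f(v) prod_j f_j(u_j / v_j) / v_j dv
    as a density of u = (x_1 v_1, ..., x_k v_k); hence g = h almost everywhere.
    The beta density vanishes unless u_j < v_j, where f_j(u_j / v_j) / v_j is, up
    to the Gamma factors, u_j^zeta_j (v_j - u_j)^(alpha_j - 1) v_j^(-zeta_j - alpha_j),
    i.e. the Kober kernel. *)

Set Implicit Arguments.
Unset Strict Implicit.

(** * Image measures and measures given by a density *)

Section packed_measures.
Local Open Scope ereal_scope.

(** The existential form hands over the image measure as a bundled measure, known only through its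
    values and its change of variables formula. *)
Lemma pushforward_measure d1 d2 (T1 : measurableType d1)
    (T2 : measurableType d2) (R : realType) (m : {measure set T1 -> \bar R})
    (phi : T1 -> T2) : measurable_fun setT phi ->
  exists nu : {measure set T2 -> \bar R},
    (forall A, nu A = m (phi @^-1` A)) /\
    (forall F : T2 -> \bar R, measurable_fun setT F -> (forall y, 0 <= F y) ->
       \int[nu]_y F y = \int[m]_x F (phi x)).
Proof.
move=> mphi; unshelve eexists (pushforward m phi) => //; split=> // F mF F0.
by rewrite ge0_integral_pushforward.
Qed.

Lemma density_measure d (T : measurableType d) (R : realType)
    (m : {measure set T -> \bar R}) (h : T -> \bar R) :
  measurable_fun setT h -> (forall t, 0 <= h t) ->
  exists nu : {measure set T -> \bar R}, forall A, nu A = \int[m]_(t in A) h t.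
Proof.
move=> mh h0; pose nu A := \int[m]_(t in A) h t.
have nu0 : nu set0 = 0 by exact: integral_set0.
have nu_ge0 A : 0 <= nu A by exact: integral_ge0.
have nuS : semi_sigma_additive nu by exact: semi_sigma_additive_nng_induced.
pose M : {measure set T -> \bar R} :=
  HB.pack nu (isMeasure.Build _ _ _ nu nu0 nu_ge0 nuS).
by exists M.
Qed.

End packed_measures.

(** * Scaling of Lebesgue measure on the line *)

Section lebesgue_scaling.
Context {R : realType}.
Local Notation leb := (@lebesgue_measure R).

(** Lebesgue measure equals [c] times its image under [x |-> c * x]: the preimage of []a, b]] is []a
    / c, b / c]], of length [(b - a) / c], and a measure with the right values on such intervals is
    Lebesgue measure. *)
Lemma ge0_integral_scale (c : R) (F : R -> \bar R) : 0 < c ->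
  measurable_fun setT F -> (forall x, 0 <= F x)%E ->
  (\int[leb]_x F x = c%:E * \int[leb]_x F (c * x)%R)%E.
Proof.
move=> c0 mF F0.
pose phi : measurableTypeR R -> measurableTypeR R := fun x => c * x.
have mphi : measurable_fun setT phi by apply: measurable_funM.
have [nu [nuE nuI]] := pushforward_measure leb mphi.
pose k : {nonneg R} := NngNum (ltW c0).
transitivity (\int[mscale k nu]_x F x)%E.
  apply: eq_measure_integral => A mA _.
  apply: lebesgue_measure_unique => // _ [[a b] _ <-].
  rewrite /= /mscale; have -> := nuE `]a, b]%classic.
  rewrite (_ : phi @^-1` _ = `](a / c), (b / c)]%classic); last first.
    apply/seteqP; split=> x /=; rewrite !in_itv /= /phi;
      by rewrite ltr_pdivrMr// ler_pdivlMr// ![x * c]mulrC.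
  rewrite !lebesgue_measure_itv /= (lebesgue_measure_itv `](a / c), (b / c)]) /=.
  rewrite !lte_fin ltr_pM2r ?invr_gt0//.
  case: ifP => _; last by rewrite mule0.
  by rewrite -!EFinB -EFinM -mulrBl mulrC divfK// gt_eqF.
by rewrite ge0_integral_mscale// nuI.
Qed.

End lebesgue_scaling.

(** * Iterated integrals as integrals against a measure on tuples *)

Section tuple_measure.
Context {R : realType}.
Local Notation leb := (@lebesgue_measure R).

Lemma measurable_cons_tuple n :
  measurable_fun [set: measurableTypeR R * n.-tuple R]
    (fun p => cons_tuple p.1 p.2 : n.+1.-tuple R).
Proof. exact: measurable_cons. Qed.

(** This opens the way from [iint] to the general theory of the integral. By induction, the measure
    on longer tuples is the image under [cons] of the product of [leb] with the previous one, and
    Tonelli matches the two integrals. Sigma-finiteness is carried along because Tonelli asks for it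
    at each stage. *)
Lemma tuple_measure n :
  exists m : {sigma_finite_measure set (n.-tuple R) -> \bar R},
  forall F : n.-tuple R -> \bar R, measurable_fun setT F ->
  (forall t, 0 <= F t)%E -> (iint F = \int[m]_t F t)%E.
Proof.
elim: n => [|n [m mE]].
  (* An iterated integral over no variables is evaluation at the empty tuple, hence a Dirac mass. *)
  exists (\d_([tuple] : 0.-tuple R)) => F mF F0.
  by rewrite integral_dirac// diracT mul1e.
pose phi p : n.+1.-tuple R := cons_tuple p.1 p.2.
have mphi : measurable_fun [set: measurableTypeR R * n.-tuple R] phi.
  exact: measurable_cons_tuple.
have [nu [nuE nuI]] := pushforward_measure (leb \x m)%E mphi.
have nu_sf : sigma_finite setT nu.
  have /sigma_finiteP[F [FT ndF Ffin]] := sigma_finiteT leb.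
  have /sigma_finiteP[G [GT ndG Gfin]] := sigma_finiteT m.
  pose psi (t : n.+1.-tuple R) : n.-tuple R := [tuple of behead t].
  (* The exhausting sets are head-tail rectangles. Both sequences increase, so head and tail fit
     together at the larger of their two indices. *)
  exists (fun i => [set t | F i (thead t) /\ G i (psi t)]).
    apply/esym; rewrite -subTset => t _.
    have [i _ Fi] : (\bigcup_i F i) (thead t) by rewrite -FT.
    have [j _ Gj] : (\bigcup_i G i) (psi t) by rewrite -GT.
    exists (maxn i j) => //; split.
      by move: Fi; exact/subsetPset/ndF/leq_maxl.
    by move: Gj; exact/subsetPset/ndG/leq_maxr.
  move=> i; have [mF Foo] := Ffin i; have [mG Goo] := Gfin i; split.
    apply: measurableI.
      rewrite -[X in measurable X]setTI; apply: measurable_tnth => //.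
    by rewrite -[X in measurable X]setTI; apply: measurable_behead.
  rewrite (_ : nu _ = leb (F i) * m (G i))%E; last first.
    rewrite [LHS]nuE -product_measure1E//; congr (_ _).
    suff psiE y t : psi (cons_tuple y t) = t.
      by apply/seteqP; split => -[y t] /=; rewrite /phi psiE theadE.
    exact/val_inj.
  by rewrite lte_mul_pinfty// ge0_fin_numE.
pose M : {sigma_finite_measure set (n.+1.-tuple R) -> \bar R} :=
  HB.pack (Measure.sort nu)
    (isSFinite.Build _ _ _ nu (sfinite_measure_sigma_finite nu_sf))
    (isSigmaFinite.Build _ _ _ nu nu_sf).
exists M => F mF F0 /=.
transitivity (\int[leb]_x \int[m]_t F (cons_tuple x t))%E.
  apply: eq_integral => x _; rewrite mE//.
  by apply: measurableT_comp => //; apply: measurable_cons.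
rewrite nuI// fubini_tonelli1//.
exact: measurableT_comp.
Qed.

Lemma eq_iint n (F G : n.-tuple R -> \bar R) : F =1 G -> iint F = iint G.
Proof. by move=> /funext ->. Qed.

Lemma ge0_iintZl n (c : R) (F : n.-tuple R -> \bar R) : 0 <= c ->
  measurable_fun setT F -> (forall t, 0 <= F t)%E ->
  (iint (fun t => c%:E * F t) = c%:E * iint F)%E.
Proof.
move=> c0 mF F0; have [m mE] := tuple_measure n.
rewrite !mE//; last by move=> t; rewrite mule_ge0.
  by rewrite ge0_integralZl//= lee_fin.
by apply: emeasurable_funM.
Qed.

Lemma measurable_fun_iint d (S : measurableType d) n
    (F : S * n.-tuple R -> \bar R) :
  measurable_fun setT F -> (forall p, 0 <= F p)%E ->
  measurable_fun setT (fun s => iint (fun t => F (s, t))).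
Proof.
move=> mF F0; have [m mE] := tuple_measure n.
rewrite (_ : (fun _ => _) = fun s => \int[m]_t F (s, t))%E.
  exact: measurable_fun_fubini_tonelli_F.
by apply/funext => s; rewrite mE//; exact: measurableT_comp.
Qed.

Lemma iint_ge0 n (F : n.-tuple R -> \bar R) :
  (forall t, 0 <= F t)%E -> (0 <= iint F)%E.
Proof.
elim: n F => [|n IHn] F F0 /=; first exact: F0.
by apply: integral_ge0 => x _; exact: IHn.
Qed.

Lemma measurable_tupleP d (S : measurableType d) n (F : 'I_n -> S -> R) :
  (forall j, measurable_fun setT (F j)) ->
  measurable_fun setT (fun s => [tuple F j s | j < n]).
Proof.
move=> mF; apply/measurable_fun_tnthP => i.
by rewrite (_ : _ \o _ = F i)//; apply/funext => s /=; rewrite tnth_mktuple.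
Qed.

Lemma mktuple_cons n (T : Type) (G : 'I_n.+1 -> T) :
  [tuple G j | j < n.+1] = cons_tuple (G ord0) [tuple G (lift ord0 j) | j < n].
Proof.
apply/eq_from_tnth => j; rewrite tnth_mktuple.
by case: (unliftP ord0 j) => [i ->|->]; rewrite ?tnthS ?tnth_mktuple.
Qed.

(** Induction on the dimension: the outer variable is rescaled by [c ord0], the inner ones by the
    induction hypothesis, and the constants collect into the Jacobian of the diagonal map. *)
Lemma iint_scale n (c : 'I_n -> R) (F : n.-tuple R -> \bar R) :
  (forall j, 0 < c j) -> measurable_fun setT F -> (forall t, 0 <= F t)%E ->
  (iint F = iint (fun t => (\prod_j c j)%:E * F [tuple (c j * tnth t j)%R | j < n]))%E.
Proof.
elim: n c F => [|n IHn] c F c0 mF F0 /=.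
  by rewrite big_ord0 mul1e; congr F; rewrite [RHS]tuple0.
have mcons x : measurable_fun setT (fun t : n.-tuple R => F (cons_tuple x t)).
  by apply: measurableT_comp => //; apply: measurable_cons.
rewrite (ge0_integral_scale (c0 ord0))//; last first.
- by move=> x; apply: iint_ge0.
- apply: (measurable_fun_iint (F := fun p => F (cons_tuple p.1 p.2))) => //.
  by apply: measurableT_comp => //; exact: measurable_cons_tuple.
rewrite -ge0_integralZl//=; last 3 first.
- apply: (measurable_fun_iint (F := fun p => F (cons_tuple (c ord0 * p.1) p.2))) => //.
  apply: measurableT_comp => //; apply: measurable_cons => //.
  exact: measurable_funM.
- by move=> x _; apply: iint_ge0.
- by rewrite lee_fin ltW.
apply: eq_integral => x _.
rewrite (IHn _ _ (fun j => c0 (lift ord0 j)) (mcons _) (fun t => F0 _)).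
have p0 : 0 <= \prod_(j < n) c (lift ord0 j) by apply: prodr_ge0 => j _; rewrite ltW.
have c00 := ltW (c0 ord0).
rewrite -ge0_iintZl//; last 2 first.
- apply: emeasurable_funM => //; apply: (measurableT_comp (mcons _)).
  apply: measurable_tupleP => j; apply: measurable_funM => //.
  exact: measurable_tnth.
- by move=> t; rewrite mule_ge0// lee_fin.
apply: eq_iint => t; rewrite muleA -EFinM big_ord_recl mktuple_cons.
congr (_ * F (cons_tuple _ _))%E.
by apply: eq_from_tnth => j; rewrite !tnth_mktuple tnthS.
Qed.

End tuple_measure.

(** * Boxes as a pi-system generating the product sigma-algebra *)

Section boxes.
Context {R : realType}.
Local Notation leb := (@lebesgue_measure R).

Lemma iint_prod n (F : 'I_n -> R -> R) :
  (forall j, measurable_fun setT (F j)) -> (forall j x, 0 <= F j x) ->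
  iint (fun t => (\prod_j F j (tnth t j))%:E) =
  (\prod_j \int[leb]_x (F j x)%:E)%E.
Proof.
elim: n F => [|n IHn] F mF F0 /=; first by rewrite !big_ord0.
rewrite big_ord_recl -IHn//.
have pF0 t : 0 <= \prod_(i < n) F (lift ord0 i) (tnth t i) by exact: prodr_ge0.
have mpF : measurable_fun setT
    (fun t : n.-tuple R => (\prod_(i < n) F (lift ord0 i) (tnth t i))%:E).
  apply/measurable_EFinP; apply: measurable_prod => i _.
  by apply: (measurableT_comp (mF _)); exact: measurable_tnth.
rewrite muleC -ge0_integralZl//=; last 3 first.
- by apply/measurable_EFinP; exact: mF.
- by move=> x _; rewrite lee_fin; exact: F0.
- exact: iint_ge0.
apply: eq_integral => x _; rewrite muleC -ge0_iintZl//.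
apply: eq_iint => t; rewrite big_ord_recl -EFinM; congr (_ * _)%:E.
by apply: eq_bigr => i _; rewrite tnthS.
Qed.

Definition box {n} (B : 'I_n -> set R) : set (n.-tuple R) :=
  [set t | forall j, B j (tnth t j)].

Definition boxes n : set (set (n.-tuple R)) :=
  [set A | exists B : 'I_n -> set R, (forall j, measurable (B j)) /\ A = box B].

Lemma measurable_box n (B : 'I_n -> set R) :
  (forall j, measurable (B j)) -> measurable (box B).
Proof.
move=> mB; rewrite (_ : box B =
    \bigcap_(j in [set: 'I_n]) (fun t : n.-tuple R => tnth t j) @^-1` B j).
  apply: fin_bigcap_measurable => // j _.
  by rewrite -[X in measurable X]setTI; exact: measurable_tnth.
by apply/seteqP; split => [t tB j _|t tB j]; exact: tB.
Qed.

Lemma setI_closed_boxes n : setI_closed (@boxes n).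
Proof.
move=> _ _ [B [mB ->]] [C [mC ->]]; exists (fun j => B j `&` C j); split.
  by move=> j; exact: measurableI.
apply/seteqP; split => t /=; first by move=> [tB tC] j; split.
by move=> tBC; split => j; have [] := tBC j.
Qed.

Lemma boxesT n : @boxes n setT.
Proof. by exists (fun=> setT); split=> //; apply/seteqP; split. Qed.

(** The sigma-algebra on tuples is generated by preimages under single coordinates, and such a
    preimage is a box whose other sides are the whole line. *)
Lemma measurable_boxes n : @measurable _ (n.-tuple R) = <<s @boxes n >>.
Proof.
apply/seteqP; split; last first.
  apply: smallest_sub; first exact: sigma_algebra_measurable.
  by move=> _ [B [mB ->]]; exact: measurable_box.
apply: smallest_sub; first exact: smallest_sigma_algebra.
move=> A; rewrite -bigcup_seq => -[i _ [B mB <-]].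
apply: sub_sigma_algebra; exists (fun j => if j == i then B else setT); split.
  by move=> j; case: ifP.
apply/seteqP; split => [t [_ tB] j|t tB]; first by case: ifP => // /eqP ->.
by split => //; have := tB i; rewrite eqxx.
Qed.

End boxes.

(** * Identifying a density on a pi-system *)

Section density_unique.
Local Open Scope ereal_scope.

Lemma density_unique d (T : measurableType d) (R : realType)
    (G : set (set T)) (nu m : {measure set T -> \bar R}) (h : T -> \bar R) :
  measurable = <<s G >> -> setI_closed G -> G setT -> nu setT < +oo ->
  measurable_fun setT h -> (forall t, 0 <= h t) ->
  (forall A, G A -> nu A = \int[m]_(t in A) h t) ->
  forall A, measurable A -> nu A = \int[m]_(t in A) h t.
Proof.
move=> mG GI GT nuT mh h0 nuh A mA.
have [nu' nu'E] := density_measure m mh h0.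
rewrite -nu'E; apply: (measure_unique G (fun=> setT)) => //.
  by rewrite bigcup_const//; exists 0%N.
by move=> B GB; rewrite nu'E nuh.
Qed.

End density_unique.

(** * Joint densities from independence *)

Section joint_laws.
Context {R : realType}.

Lemma integral_indicM d (T : measurableType d) (m : {measure set T -> \bar R})
    (A : set T) (h : T -> R) :
  (\int[m]_(t in A) (h t)%:E = \int[m]_t (\1_A t * h t)%:E)%E.
Proof.
by rewrite integral_mkcond; apply: eq_integral => t _;
  rewrite epatch_indic /= -EFinM mulrC.
Qed.

Context d (T : measurableType d) (P : probability T R).

(** Both sides are finite measures in [A], so boxes suffice. There independence factors the
    probability, and [iint_prod] factors the integral. *)
Lemma independent_joint_density n (x : 'I_n -> T -> R) (p : 'I_n -> R -> R) :
  (forall j, measurable_fun setT (x j)) ->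
  (forall j, has_density1 P (x j) (p j)) ->
  mutually_independent P x ->
  has_joint_density P (fun w => [tuple x j w | j < n])
    (fun t => \prod_j p j (tnth t j)).
Proof.
move=> mx dx indx.
have mp j : measurable_fun setT (p j) by have [] := dx j.
have p0 j y : 0 <= p j y by have [_ + _] := dx j.
have mpp : measurable_fun setT (fun t : n.-tuple R => \prod_j p j (tnth t j)).
  apply: measurable_prod => j _.
  by apply: (measurableT_comp (mp j)); exact: measurable_tnth.
split => [//|t|A mA]; first exact: prodr_ge0.
have [m mE] := tuple_measure (R:=R) n.
have mX : measurable_fun setT (fun w => [tuple x j w | j < n]).
  exact: measurable_tupleP.
have [nu [nuE _]] := pushforward_measure P mX.
have iintE B : measurable B ->
  iint (fun t => (\1_B t * \prod_j p j (tnth t j))%:E) =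
  (\int[m]_(t in B) (\prod_j p j (tnth t j))%:E)%E.
  move=> mB; rewrite integral_indicM mE//.
    by apply/measurable_EFinP; apply: measurable_funM.
  by move=> t; rewrite lee_fin mulr_ge0// prodr_ge0.
rewrite iintE// -[LHS]nuE.
apply: (density_unique (G := @boxes R n)) => //.
- exact: measurable_boxes.
- exact: setI_closed_boxes.
- exact: boxesT.
- by rewrite (_ : nu setT = 1%E) ?ltry// -(probability_setT P); exact: nuE.
- exact/measurable_EFinP.
- by move=> t; rewrite lee_fin prodr_ge0.
move=> _ [B [mB ->]]; rewrite nuE -iintE; last exact: measurable_box.
rewrite (_ : _ @^-1` _ = \bigcap_(j in [set: 'I_n]) (x j @^-1` B j)); last first.
  apply/seteqP; split => [w wB j _|w wB j].
    by have := wB j; rewrite tnth_mktuple.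
  by rewrite tnth_mktuple; exact: wB.
transitivity (\prod_(j < n) P (x j @^-1` B j))%E; first exact: indx.
transitivity (iint (fun t : n.-tuple R =>
    (\prod_j (\1_(B j) (tnth t j) * p j (tnth t j)))%:E)).
  rewrite (iint_prod (F := fun j y => \1_(B j) y * p j y)); last 2 first.
  - by move=> j; apply: measurable_funM.
  - by move=> j y; rewrite mulr_ge0.
  apply: eq_bigr => j _; have [_ _ ->//] := dx j.
  by rewrite -integral_indicM.
apply: eq_iint => t; congr _%:E; rewrite big_split /=; congr (_ * _).
(* The indicator of a box is the product of the indicators of its sides: outside the box, one
   failing side annihilates the product. *)
rewrite indicE; case: (boolP (t \in _)) => [|/negP] tB.
  move/set_mem in tB; rewrite big1// => j _.
  by rewrite indicE mem_set//; exact: tB.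
have [j Bj] : exists j, ~ B j (tnth t j).
  by apply/existsNP => tB'; apply: tB; exact/mem_set.
by rewrite (bigD1 j)//= indicE memNset// mul0r.
Qed.

(** Here the pi-system consists of the measurable rectangles. The integral over [x] is placed
    innermost so that a substitution in [x] can later be made at fixed [v]. *)
Lemma independent_vectors_density n k (X : T -> n.-tuple R) (V : T -> k.-tuple R)
    (p : n.-tuple R -> R) (f : k.-tuple R -> R) :
  measurable_fun setT X -> measurable_fun setT V ->
  has_joint_density P X p -> has_joint_density P V f ->
  independent_vectors P X V ->
  forall C : set (n.-tuple R * k.-tuple R), measurable C ->
  P [set w | C (X w, V w)] =
  iint (fun v => iint (fun x => (\1_C (x, v) * (p x * f v))%:E)).
Proof.
move=> mX mV [mp p0 pE] [mf f0 fE] indXV C mC.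
have [m mE] := tuple_measure (R:=R) n.
have [m' m'E] := tuple_measure (R:=R) k.
have mXV : measurable_fun setT (fun w => (X w, V w)).
  exact/measurable_fun_pair.
have [nu [nuE _]] := pushforward_measure P mXV.
pose h (z : n.-tuple R * k.-tuple R) := p z.1 * f z.2.
have mh : measurable_fun setT h.
  by apply: measurable_funM; exact: measurableT_comp.
have h0 z : 0 <= h z by exact: mulr_ge0.
have iintE B : measurable B ->
  iint (fun v => iint (fun x => (\1_B (x, v) * (p x * f v))%:E)) =
  (\int[m \x m']_(z in B) (h z)%:E)%E.
  move=> mB; have mBh : measurable_fun setT (fun z => (\1_B z * h z)%:E).
    by apply/measurable_EFinP; apply: measurable_funM.
  have Bh0 z : (0 <= (\1_B z * h z)%:E)%E by rewrite lee_fin mulr_ge0.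
  rewrite integral_indicM fubini_tonelli2// m'E.
  - apply: eq_integral => v _; rewrite mE//.
    exact: (measurableT_comp mBh).
  - apply: (measurable_fun_iint (F := fun z => (\1_B (z.2, z.1) * h (z.2, z.1))%:E)) => //.
    apply: (measurableT_comp mBh); exact/measurable_fun_pair.
  - by move=> v; apply: iint_ge0.
rewrite iintE// -[LHS]nuE.
apply: (density_unique (G := [set A `*` B | A in measurable & B in measurable])) => //.
- exact: measurable_prod_measurableType.
- move=> _ _ [A mA [B mB <-]] [A' mA' [B' mB' <-]].
  exists (A `&` A'); first exact: measurableI.
  by exists (B `&` B'); [exact: measurableI|rewrite setXI].
- by exists setT => //; exists setT => //; rewrite setXTT.
- by rewrite (_ : nu setT = 1%E) ?ltry// -(probability_setT P); exact: nuE.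
- exact/measurable_EFinP.
move=> _ [A mA [B mB <-]]; rewrite -iintE; last exact: measurableX.
transitivity (P (X @^-1` A `&` V @^-1` B)); first by rewrite nuE.
have mpA : measurable_fun setT (fun x => (\1_A x * p x)%:E).
  by apply/measurable_EFinP; apply: measurable_funM.
have mfB : measurable_fun setT (fun v => (\1_B v * f v)%:E).
  by apply/measurable_EFinP; apply: measurable_funM.
(* This value is the probability that [X] lies in [A]; being finite, it can pass as a real constant
   through the integral over [v]. *)
have pA_fin : iint (fun x => (\1_A x * p x)%:E) \is a fin_num.
  rewrite -pE//; apply: fin_num_measure.
  by rewrite -[X in measurable X]setTI; exact: mX.
rewrite indXV// fE// pE// -(fineK pA_fin) -ge0_iintZl//; last 2 first.
- by apply: fine_ge0; apply: iint_ge0 => x; rewrite lee_fin mulr_ge0.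
- by move=> v; rewrite lee_fin mulr_ge0.
apply: eq_iint => v; rewrite fineK// muleC -ge0_iintZl//; last 2 first.
- by rewrite mulr_ge0.
- by move=> x; rewrite lee_fin mulr_ge0.
apply: eq_iint => x; rewrite -EFinM; congr _%:E.
rewrite (_ : \1_(A `*` B) (x, v) = \1_A x * \1_B v); last first.
  rewrite !indicE in_setX.
  by case: (x \in A); case: (v \in B); rewrite /= ?mul1r ?mulr0 ?mul0r.
by rewrite mulrACA [\1_B v * _]mulrC [f v * _]mulrC.
Qed.

End joint_laws.

(** * Density of a coordinatewise product *)

Section product_density.
Context {R : realType}.

Lemma iint_swap n k (F : n.-tuple R * k.-tuple R -> \bar R) :
  measurable_fun setT F -> (forall z, 0 <= F z)%E ->
  iint (fun s => iint (fun t => F (s, t))) =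
  iint (fun t => iint (fun s => F (s, t))).
Proof.
move=> mF F0.
have [m mE] := tuple_measure (R:=R) n; have [m' m'E] := tuple_measure (R:=R) k.
have mFr : measurable_fun setT (fun z => F (z.2, z.1)).
  by apply: (measurableT_comp mF); exact/measurable_fun_pair.
have h1 := measurable_fun_iint mF F0.
have h2 := measurable_fun_iint mFr (fun z => F0 _).
rewrite mE//; last by move=> s; exact: iint_ge0.
rewrite m'E//; last by move=> s; exact: iint_ge0.
transitivity (\int[m]_s \int[m']_t F (s, t))%E.
  apply: eq_integral => s _; rewrite m'E//; exact: measurableT_comp.
rewrite fubini_tonelli//; apply: eq_integral => t _; rewrite mE//.
exact: measurableT_comp.
Qed.

Lemma measurable_posorthant n : measurable (@posorthant R n).
Proof.
rewrite (_ : @posorthant R n = box (fun=> `]0, +oo[%classic)).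
  by apply: measurable_box => j; exact: measurable_itv.
by apply/seteqP; split => t tO j; have := tO j; rewrite /= in_itv /= andbT.
Qed.

(* [v `^ (-1)] stands for [v^-1] (they agree for [0 < v]): measurability of real
   powers is available, that of the inverse is not. *)
Definition product_kernel {n} (p : 'I_n -> R -> R) (f : n.-tuple R -> R)
    (u v : n.-tuple R) : R :=
  \1_(@posorthant R n) v * f v *
  \prod_j (p j (tnth u j * tnth v j `^ (-1)) * tnth v j `^ (-1)).

Section product_kernel.
Context {n : nat} (p : 'I_n -> R -> R) (f : n.-tuple R -> R).
Hypothesis mp : forall j, measurable_fun setT (p j).
Hypothesis p0 : forall j y, 0 <= p j y.
Hypothesis mf : measurable_fun setT f.
Hypothesis f0 : forall v, 0 <= f v.

Lemma product_kernel_ge0 u v : 0 <= product_kernel p f u v.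
Proof.
by rewrite mulr_ge0 ?prodr_ge0// ?mulr_ge0// => j _; rewrite mulr_ge0// powR_ge0.
Qed.

Lemma measurable_product_kernel :
  measurable_fun setT (fun z => product_kernel p f z.1 z.2).
Proof.
have mt1 j : measurable_fun setT (fun z : n.-tuple R * n.-tuple R => tnth z.1 j).
  exact: (measurableT_comp (measurable_tnth _)).
have mt2 j : measurable_fun setT (fun z : n.-tuple R * n.-tuple R => tnth z.2 j `^ (-1)).
  apply: (measurableT_comp (measurable_powR _)).
  exact: (measurableT_comp (measurable_tnth _)).
apply: measurable_funM.
  apply: (@measurableT_comp _ _ _ _ _ _ (fun v => \1_(@posorthant R n) v * f v)) => //.
  apply: measurable_funM => //; apply: measurable_indic.
  exact: measurable_posorthant.
apply: measurable_prod => j _; apply: measurable_funM => //.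
by apply: (measurableT_comp (mp j)); exact: measurable_funM.
Qed.

Lemma measurable_product_kernelr u : measurable_fun setT (product_kernel p f u).
Proof.
exact: (measurableT_comp measurable_product_kernel (pair1_measurable u)).
Qed.

(** The event that the product lies in [B] is an event about the pair of vectors, so its probability
    is a double integral; at fixed [v] the substitution [x_j = u_j / v_j] turns the inner integral
    into one over [u]. *)
Lemma product_density d (T : measurableType d) (P : probability T R)
    (x v : 'I_n -> T -> R) :
  (forall j, measurable_fun setT (x j)) ->
  (forall j, measurable_fun setT (v j)) ->
  has_joint_density P (fun w => [tuple x j w | j < n])
    (fun t => \prod_j p j (tnth t j)) ->
  (forall j w, 0 < v j w) ->
  has_joint_density P (fun w => [tuple v j w | j < n]) f ->
  independent_vectors P (fun w => [tuple x j w | j < n])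
                        (fun w => [tuple v j w | j < n]) ->
  forall B, measurable B ->
  P ((fun w => [tuple x j w * v j w | j < n]) @^-1` B) =
  iint (fun u => (\1_B u)%:E * iint (fun t => (product_kernel p f u t)%:E))%E.
Proof.
move=> mx mv dX v0 dV indXV B mB.
pose mul (z : n.-tuple R * n.-tuple R) := [tuple tnth z.1 j * tnth z.2 j | j < n].
(* Adding the orthant condition leaves the event unchanged, as every [v j w] is positive, and
   restricts the substitution to positive scaling factors. *)
pose C z := B (mul z) /\ posorthant z.2.
have mmul : measurable_fun setT mul.
  apply: measurable_tupleP => j; apply: measurable_funM;
    exact: (measurableT_comp (measurable_tnth _)).
have mC : measurable (C : set _).
  apply: measurableI.
    by rewrite -[X in measurable X]setTI; exact: mmul.
  rewrite -[X in measurable X]setTI; apply: measurable_snd => //.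
  exact: measurable_posorthant.
transitivity (P [set w | C ([tuple x j w | j < n], [tuple v j w | j < n])]).
  congr (P _); apply/seteqP; split=> w /=; rewrite /C /mul /=.
    move=> Bw; split; last by move=> j; rewrite tnth_mktuple.
    by under eq_mktuple do rewrite !tnth_mktuple.
  by case; under eq_mktuple do rewrite !tnth_mktuple.
rewrite (independent_vectors_density _ _ dX dV indXV)//; last 2 first.
- exact: measurable_tupleP.
- exact: measurable_tupleP.
have [mpp pp0 _] := dX.
pose K (z : n.-tuple R * n.-tuple R) := (\1_B z.1 * product_kernel p f z.1 z.2)%:E.
have mK : measurable_fun setT K.
  apply/measurable_EFinP; apply: measurable_funM; last exact: measurable_product_kernel.
  apply: (@measurableT_comp _ _ _ _ _ _ (\1_B : _ -> R)) => //.
have K0 z : (0 <= K z)%E by rewrite lee_fin mulr_ge0 ?product_kernel_ge0.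
transitivity (iint (fun u => iint (fun t => K (u, t)))); last first.
  apply: eq_iint => u; rewrite -ge0_iintZl//.
  - by apply/measurable_EFinP; exact: measurable_product_kernelr.
  - by move=> t; rewrite lee_fin product_kernel_ge0.
(* With the integral over [v] outermost on both sides, the inner integrals are compared at a fixed
   value [t] of [v]. *)
rewrite iint_swap//; apply: eq_iint => t.
have [tO|tO] := pselect (posorthant t); last first.
  (* Off the orthant both integrands vanish: on one side through [C], on the other through the
     indicator built into the kernel. *)
  apply: eq_iint => u; rewrite /K /product_kernel /= !indicE.
  rewrite (memNset tO) memNset ?mul0r ?mulr0//.
  by case.
have tV j : tnth t j `^ (-1) = (tnth t j)^-1 by rewrite powR_inv1// ltW.
(* The substitution divides each coordinate by [v_j]; its Jacobian supplies the factors [v_j^-1] of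
   the kernel. *)
rewrite (iint_scale (c := fun j => (tnth t j)^-1)); last 3 first.
- by move=> j; rewrite invr_gt0; exact: tO.
- apply/measurable_EFinP; apply: measurable_funM; last exact: measurable_funM.
  apply: (@measurableT_comp _ _ _ _ _ _ (\1_C : _ -> R)) => //.
- by move=> s; rewrite lee_fin !mulr_ge0.
apply: eq_iint => u; rewrite -EFinM; congr _%:E.
rewrite /K /product_kernel /= [\1_(@posorthant R n) _]indicE (mem_set tO) mul1r.
have -> : \1_C ([tuple (tnth t j)^-1 * tnth u j | j < n], t) = \1_B u :> R.
  rewrite !indicE; congr ((nat_of_bool _)%:R).
  have mulE : mul ([tuple (tnth t j)^-1 * tnth u j | j < n], t) = u.
    apply: eq_from_tnth => j; rewrite !tnth_mktuple /= mulrAC mulVf ?mul1r//.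
    by rewrite gt_eqF//; exact: tO.
  by apply/idP/idP; rewrite !inE /C mulE//=; case.
have -> : \prod_(j < n) (p j (tnth u j * tnth t j `^ (-1)) * tnth t j `^ (-1)) =
    \prod_(j < n) (tnth t j)^-1 *
    \prod_(j < n) p j (tnth [tuple (tnth t i)^-1 * tnth u i | i < n] j).
  rewrite -big_split /=; apply: eq_bigr => j _.
  by rewrite tnth_mktuple tV mulrC [_ * tnth u j]mulrC.
by rewrite mulrCA; congr (_ * _); rewrite mulrA mulrC.
Qed.

End product_kernel.
End product_density.

(** * Almost everywhere uniqueness of densities, and the Kober kernel *)

Section Kober.
Context {R : realType}.

(** Functions with equal integrals over every measurable set agree almost everywhere once one of
    them is integrable, here [g]. The values of [h] are extended reals because it will be an
    iterated integral, which may be infinite at some points. *)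
Lemma joint_density_ae_unique n (g : n.-tuple R -> R) (h : n.-tuple R -> \bar R) :
  measurable_fun setT g -> (forall u, 0 <= g u) ->
  measurable_fun setT h -> (forall u, 0 <= h u)%E ->
  (iint (fun u => (g u)%:E) < +oo)%E ->
  (forall B, measurable B ->
     iint (fun u => (\1_B u * g u)%:E) = iint (fun u => (\1_B u)%:E * h u)%E) ->
  exists N : set (n.-tuple R),
    measurable N /\ lebn N = 0%E /\ forall u, ~ N u -> (g u)%:E = h u.
Proof.
move=> mg g0 mh h0 gfin gh; have [m mE] := tuple_measure (R:=R) n.
have mG : measurable_fun setT (EFin \o g) by exact/measurable_EFinP.
have mB B : measurable B -> measurable_fun setT (\1_B : n.-tuple R -> R).
  by move=> ?; exact: measurable_indic.
have gint : m.-integrable setT (EFin \o g).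
  apply/integrableP; split => //.
  rewrite (eq_integral (EFin \o g)); last by move=> u _; rewrite /= ger0_norm.
  by rewrite -mE// => u; rewrite lee_fin.
have ghE E : E `<=` setT -> measurable E ->
    (\int[m]_(u in E) (EFin \o g) u = \int[m]_(u in E) h u)%E.
  move=> _ mE'; rewrite integral_indicM [RHS]integral_mkcond -!mE.
  - rewrite gh//; apply: eq_iint => u.
    by rewrite epatch_indic /= muleC.
  - rewrite epatch_indic; apply: emeasurable_funM => //.
    by apply/measurable_EFinP; exact: mB.
  - by move=> u; rewrite epatch_indic /= mule_ge0// lee_fin.
  - by apply/measurable_EFinP; apply: measurable_funM => //; exact: mB.
  - by move=> u; rewrite lee_fin mulr_ge0.
have [N [mN N0 subN]] := integral_ae_eq measurableT gint mh ghE.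
exists N; split => //; split.
  rewrite /lebn mE; last 2 first.
  - by apply/measurable_EFinP; exact: mB.
  - by move=> u; rewrite lee_fin.
  by rewrite integral_indic// setIT.
by move=> u Nu; apply: contrapT => gu; apply/Nu/subN => /= /(_ Logic.I).
Qed.

Lemma Gamma_ge0 (s : R) : 0 <= Gamma s.
Proof.
apply: fine_ge0; apply: integral_ge0 => t _.
by rewrite lee_fin mulr_ge0 ?powR_ge0 ?expR_ge0.
Qed.

(* A density integrates to 1, so the normalising constant cannot vanish. *)
Lemma beta1_density_Gamma_neq0 d (T : measurableType d) (P : probability T R)
    (x : T -> R) (zeta alpha : R) :
  has_density1 P x (beta1_pdf zeta alpha) ->
  Gamma (zeta + 1) != 0 /\ Gamma (alpha + zeta + 1) != 0.
Proof.
move=> [_ _ dx]; apply/andP; rewrite -negb_or; apply/negP => G0.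
have := dx _ measurableT; rewrite preimage_setT probability_setT.
rewrite integral0_eq => [[/eqP]|y _]; first by rewrite oner_eq0.
rewrite /beta1_pdf; case: ifP => // _.
(* Since the inverse of 0 is 0, a vanishing Gamma value makes the density 0 whether it sits in the
   numerator or in the denominator. *)
by case/orP: G0 => /eqP ->; rewrite ?mulr0 ?invr0 ?mulr0 ?mul0r ?mul0r.
Qed.

(** The powers of [v] come from three sources: [- zeta] from [(u / v) ^ zeta], [1 - alpha] from
    [(1 - u / v) ^ (alpha - 1)], and [-1] from the Jacobian. Their sum is [- zeta - alpha]. *)
Lemma beta1_pdf_ratio (zeta alpha u v : R) :
  Gamma (zeta + 1) != 0 -> Gamma (alpha + zeta + 1) != 0 -> 0 < u -> u < v ->
  Gamma (zeta + 1) / Gamma (alpha + zeta + 1) *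
    (beta1_pdf zeta alpha (u * v `^ (-1)) * v `^ (-1)) =
  u `^ zeta / Gamma alpha * ((v - u) `^ (alpha - 1) * v `^ (- zeta - alpha)).
Proof.
move=> G1 G2 u0 uv; have v0 : 0 < v := lt_trans u0 uv.
have vu0 : 0 < v - u by rewrite subr_gt0.
have vn0 : v != 0 by rewrite gt_eqF.
rewrite powR_inv1 ?ltW// /beta1_pdf divr_gt0//= ltr_pdivrMr// mul1r uv.
have -> : 1 - u / v = (v - u) / v by rewrite mulrBl divff.
rewrite -!(powR_inv1 (ltW v0)) !powRM ?powR_ge0 ?ltW// -!powRrM.
have -> : v `^ (- zeta - alpha) = v `^ (-1 * zeta) * v `^ (-1 * (alpha - 1)) * v `^ (-1).
  rewrite -!powRD ?vn0 ?implybT//; congr (_ `^ _).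
  by rewrite !mulN1r opprB [1 - alpha]addrC addrA addrK.
(* The Gamma values become opaque, and the quotients [a / a] and [b / b] are set apart, so that what
   remains is a ring identity. *)
move: G1 G2; move: (Gamma (zeta + 1)) (Gamma (alpha + zeta + 1)) (Gamma alpha).
move=> a b c a0 b0; rewrite invfM.
transitivity ((a / a) * (b / b) * (u `^ zeta / c * ((v - u) `^ (alpha - 1) *
    (v `^ (-1 * zeta) * v `^ (-1 * (alpha - 1)) * v `^ (-1))))); first ring.
by rewrite (divff a0) (divff b0) !mul1r.
Qed.

Lemma beta1_pdf_ge1 (zeta alpha y : R) : 1 <= y -> beta1_pdf zeta alpha y = 0.
Proof. by move=> y1; rewrite /beta1_pdf [y < 1]ltNge y1 andbF. Qed.

(** Once the constants are moved under the integral signs, the two integrands agree at every [v]: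
    coordinatewise by [beta1_pdf_ratio] where all [u_j < v_j], and by vanishing elsewhere. *)
Lemma Kober2_product_kernel k (zeta alpha : 'I_k -> R) (f : k.-tuple R -> R)
    (u : k.-tuple R) :
  (forall j, Gamma (zeta j + 1) != 0) ->
  (forall j, Gamma (alpha j + zeta j + 1) != 0) ->
  (forall j, measurable_fun setT (beta1_pdf (zeta j) (alpha j))) ->
  (forall j y, 0 <= beta1_pdf (zeta j) (alpha j) y) ->
  measurable_fun setT f -> (forall v, 0 <= f v) -> posorthant u ->
  (Kober2 zeta alpha f u =
  (\prod_(j < k) (Gamma (zeta j + 1) / Gamma (alpha j + zeta j + 1)))%:E *
   iint (fun v => (product_kernel (fun j => beta1_pdf (zeta j) (alpha j)) f u v)%:E))%E.
Proof.
move=> G1 G2 mp p0 mf f0 u0; rewrite /Kober2.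
set U := [set v | _].
have mU : measurable (U : set (k.-tuple R)).
  rewrite (_ : U = box (fun j => `]tnth u j, +oo[%classic)).
    by apply: measurable_box => j; exact: measurable_itv.
  by apply/seteqP; split => v vU j; have := vU j; rewrite /= in_itv /= andbT.
rewrite -!ge0_iintZl.
- apply: eq_iint => v; rewrite -!EFinM; congr _%:E; rewrite /product_kernel.
  have [vU|vU] := pselect (U v); last first.
    rewrite [\1_U _]indicE (memNset vU) mul0r mulr0.
    have [vO|vO] := pselect (posorthant v); last first.
      by rewrite [\1_(@posorthant R k) _]indicE (memNset vO) !mul0r mulr0.
    (* Some coordinate has [v_j <= u_j], so its beta density is evaluated at a ratio at least 1 and
       the product is 0. *)
    have /existsNP[j /negP] := vU; rewrite -leNgt => vuj.
    rewrite [X in _ = _ * (_ * X)](bigD1 j)//= beta1_pdf_ge1 ?mul0r ?mulr0//.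
    by rewrite (powR_inv1 (ltW (vO j))) ler_pdivlMr ?mul1r//; exact: vO.
  have vO : posorthant v by move=> j; exact: lt_trans (u0 j) (vU j).
  rewrite [\1_U _]indicE (mem_set vU) [\1_(@posorthant R k) _]indicE (mem_set vO) !mul1r.
  set q := \prod_(j < k) (_ / Gamma (alpha j)); set r := \prod_(j < k) _.
  set c := \prod_(j < k) _; set s := \prod_(j < k) _.
  suff qrE : q * r = c * s by rewrite mulrA qrE mulrCA mulrC mulrA mulrAC.
  rewrite /q /r /c /s -2!big_split; apply: eq_bigr => j _.
  exact/esym/beta1_pdf_ratio.
- by apply: prodr_ge0 => j _; rewrite divr_ge0 ?Gamma_ge0.
- by apply/measurable_EFinP; exact: measurable_product_kernelr.
- by move=> v; rewrite lee_fin product_kernel_ge0.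
- by apply: prodr_ge0 => j _; rewrite divr_ge0 ?Gamma_ge0 ?powR_ge0.
- apply/measurable_EFinP; apply: measurable_funM; first exact: measurable_indic.
  apply: measurable_funM => //; apply: measurable_prod => j _.
  apply: measurable_funM; apply: (measurableT_comp (measurable_powR _)).
    by apply: measurable_funB => //; exact: measurable_tnth.
  exact: measurable_tnth.
- move=> v; rewrite lee_fin !mulr_ge0// prodr_ge0// => j _.
  by rewrite mulr_ge0 ?powR_ge0.
Qed.

End Kober.

Theorem theorem1p1 (R : realType) (k : nat) (zeta alpha : 'I_k -> R)
  (d : measure_display) (T : measurableType d) (P : probability T R)
  (x v : 'I_k -> T -> R) (f g : k.-tuple R -> R) :
  (0 < k)%N ->
  (forall j, -1 < zeta j) ->
  (forall j, 0 < alpha j) ->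
  (forall j, measurable_fun setT (x j)) ->
  (forall j, measurable_fun setT (v j)) ->
  (forall j, has_density1 P (x j) (beta1_pdf (zeta j) (alpha j))) ->
  mutually_independent P x ->
  (forall j w, 0 < v j w) ->
  has_joint_density P (fun w => [tuple v j w | j < k]) f ->
  independent_vectors P (fun w => [tuple x j w | j < k])
                        (fun w => [tuple v j w | j < k]) ->
  has_joint_density P (fun w => [tuple x j w * v j w | j < k]) g ->
  ae_lebn (@posorthant R k) (fun u =>
    ((\prod_(j < k) (Gamma (zeta j + 1) / Gamma (alpha j + zeta j + 1)))
       * g u)%:E = Kober2 zeta alpha f u).
Proof.
move=> _ _ _ mx mv dx indx v0 dv indxv [mg g0 gE].
pose p j := beta1_pdf (zeta j) (alpha j).
have mp j : measurable_fun setT (p j) by have [] := dx j.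
have p0 j y : 0 <= p j y by have [_ + _] := dx j; exact.
have [mf f0 _] := dv.
have dX := independent_joint_density mx dx indx.
have uE := product_density mp p0 mf f0 mx mv dX v0 dv indxv.
have [||||N [mN [N0 Nu]]] := joint_density_ae_unique
  (h := fun u => iint (fun t => (product_kernel p f u t)%:E)) mg g0.
- apply: (measurable_fun_iint (F := fun z => (product_kernel p f z.1 z.2)%:E)).
    by apply/measurable_EFinP; exact: measurable_product_kernel.
  by move=> z; rewrite lee_fin product_kernel_ge0.
- by move=> u; apply: iint_ge0 => t; rewrite lee_fin product_kernel_ge0.
(* The total mass of [g] is the probability of the whole space, obtained by testing its density
   property on [setT]. *)
- rewrite (eq_iint (G := fun u => (\1_setT u * g u)%:E)); last first.
    by move=> u; rewrite indicT mul1r.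
  by rewrite -gE// preimage_setT probability_setT ltry.
- by move=> B mB; rewrite -gE// uE.
(* Only the passage from [g] to the integral [h] costs a null set; the identification of [h] with
   the Kober integral holds at every point of the orthant. *)
exists N; split => //; split => // u uO uN.
have G1 j : Gamma (zeta j + 1) != 0.
  by have [] := beta1_density_Gamma_neq0 (dx j).
have G2 j : Gamma (alpha j + zeta j + 1) != 0.
  by have [] := beta1_density_Gamma_neq0 (dx j).
by rewrite EFinM (Nu _ uN) (Kober2_product_kernel G1 G2 mp p0 mf f0 uO).
Qed.
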